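(* A ring $R$ is central reduced if and only if the Dorroh extension $D(R,\mathbb{Z})$ of $R$ is central reduced.
   Context: All rings are associative with identity, not necessarily commutative. A ring $R$ is called central reduced if every nilpotent element of $R$ is central. The Dorroh extension $D(R,\mathbb{Z})=\{(r,n): r\in R,\ n\in\mathbb{Z}\}$ of a ring $R$ is the ring with operations $(r_1,n_1)+(r_2,n_2)=(r_1+r_2,n_1+n_2)$ and $(r_1,n_1)(r_2,n_2)=(r_1r_2+n_1r_2+n_2r_1,\ n_1n_2)$. *)

(* Defs.v *)
From HB Require Import structures.
From mathcomp Require Import all_boot all_order all_algebra.

Set Implicit Arguments.
Unset Strict Implicit.
Unset Printing Implicit Defensive.

Import GRing.Theory.
Local Open Scope ring_scope.

Definition is_nilpotent (R : pzRingType) (x : R) : Prop :=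
  exists n : nat, x ^+ n = 0.

Definition is_central (R : pzRingType) (x : R) : Prop :=
  forall y : R, x * y = y * x.

(* [pzRingType] rather than [nzRingType]: the zero ring is a ring with
   identity. *)
Definition central_reduced (R : pzRingType) : Prop :=
  forall x : R, is_nilpotent x -> is_central x.

(* An alias of [R * int], so as to carry the Dorroh multiplication instead of
   the componentwise one; the additive structure is that of the product. *)
Definition dorroh (R : pzRingType) : Type := (R * int)%type.

Section Dorroh.

Variable R : pzRingType.

#[warning="-redundant-canonical-projection"]
HB.instance Definition _ := GRing.Zmodule.copy (dorroh R) (R * int)%type.

Definition dorroh_one : dorroh R := (0, 1).

Definition dorroh_mul (x y : dorroh R) : dorroh R :=
  (x.1 * y.1 + y.1 *~ x.2 + x.1 *~ y.2, x.2 * y.2).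

Fact dorroh_mulA : associative dorroh_mul.
Proof.
move=> [a i] [b j] [c k]; rewrite /dorroh_mul /=; congr pair; last exact: mulrA.
rewrite !mulrDl !mulrDr !mulrzDl !mulrzAl !mulrzAr !mulrA -!mulrzA.
rewrite (mulrC j i) (mulrC k i) -!addrA; congr (_ + _).
rewrite [RHS]addrCA; congr (_ + _); rewrite addrCA; congr (_ + _).
exact: addrCA.
Qed.

Fact dorroh_mul1x : left_id dorroh_one dorroh_mul.
Proof. by move=> [a i]; rewrite /dorroh_mul /= !mul0r mul0rz add0r addr0 mul1r. Qed.

Fact dorroh_mulx1 : right_id dorroh_one dorroh_mul.
Proof. by move=> [a i]; rewrite /dorroh_mul /= !mulr0 mul0rz !add0r mulr1. Qed.

Fact dorroh_mulDl : left_distributive dorroh_mul +%R.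
Proof.
move=> [a i] [b j] [c k]; apply: (congr2 pair) => /=; last exact: mulrDl.
by rewrite mulrDl mulrzDl mulrzDr (addrACA (a * c)) [LHS]addrACA.
Qed.

Fact dorroh_mulDr : right_distributive dorroh_mul +%R.
Proof.
move=> [a i] [b j] [c k]; apply: (congr2 pair) => /=; last exact: mulrDr.
by rewrite mulrDr mulrzDl mulrzDr (addrACA (a * b)) [LHS]addrACA.
Qed.

HB.instance Definition _ := GRing.Zmodule_isPzRing.Build (dorroh R)
  dorroh_mulA dorroh_mul1x dorroh_mulx1 dorroh_mulDl dorroh_mulDr.

End Dorroh.

(* Main.v *)
Require Import Defs.
From mathcomp Require Import all_boot all_order all_algebra.

(* Since Z is reduced, a nilpotent element of the Dorroh extension has integer
   component 0, so it lies in the copy R x 0 of R; and as integers act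
   centrally, (a, 0) is central in the extension iff a is central in R. *)

Import GRing.Theory.
Local Open Scope ring_scope.

Lemma dorrohM (R : pzRingType) (x y : dorroh R) :
  x * y = (x.1 * y.1 + y.1 *~ x.2 + x.1 *~ y.2, x.2 * y.2).
Proof. by []. Qed.

Lemma dorroh_exp_snd (R : pzRingType) (x : dorroh R) (n : nat) :
  (x ^+ n).2 = x.2 ^+ n.
Proof. by elim: n => [|n IHn] //; rewrite !exprS dorrohM /= IHn. Qed.

(** The exponent has to be positive: the zeroth power is the identity [(0, 1)], not [(1, 0)]. *)
Lemma dorroh_exp_fst (R : pzRingType) (a : R) (n : nat) :
  ((a, 0) : dorroh R) ^+ n.+1 = (a ^+ n.+1, 0).
Proof.
elim: n => [|n IHn]; first by rewrite !expr1.
by rewrite exprS IHn dorrohM /= !mulr0z !addr0 mulr0 -exprS.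
Qed.

Lemma dorroh_central_fst (R : pzRingType) (a : R) :
  is_central ((a, 0) : dorroh R) <-> is_central a.
Proof.
split=> ca.
  move=> b; have := ca (b, 0).
  by rewrite !dorrohM /= !mulr0z !addr0 => -[].
(* Both products carry the same cross term [a *~ k], so only [a * b = b * a] remains. *)
by move=> [b k]; rewrite !dorrohM /= !mulr0z !addr0 mul0r mulr0 ca.
Qed.

(** Provides the positive exponent that [dorroh_exp_fst] requires; one more factor [x] keeps a zero
    power zero. *)
Lemma nilpotentS (R : pzRingType) (x : R) :
  is_nilpotent x <-> exists n : nat, x ^+ n.+1 = 0.
Proof.
split=> -[n xn0]; last by exists n.+1.
by exists n; rewrite exprS xn0 mulr0.
Qed.

Lemma dorroh_nilpotent (R : pzRingType) (x : dorroh R) :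
  is_nilpotent x <-> x.2 = 0 /\ is_nilpotent x.1.
Proof.
split.
  case: x => a k /nilpotentS[n xn0].
  have k0 : k = 0.
    have := congr1 snd xn0; rewrite dorroh_exp_snd => /eqP.
    by rewrite expf_eq0 => /andP[_ /eqP].
  split=> //; apply/nilpotentS; exists n.
  by move: xn0; rewrite k0 dorroh_exp_fst => -[].
case: x => a k /= [-> /nilpotentS[n an0]].
by exists n.+1; rewrite dorroh_exp_fst an0.
Qed.

Theorem proposition2p27 (R : pzRingType) :
  central_reduced R <-> central_reduced (dorroh R).
Proof.
split=> redR.
  move=> [a k] /dorroh_nilpotent /= [-> nil_a].
  by apply/dorroh_central_fst/redR.
move=> a nil_a; apply/dorroh_central_fst/redR.
by apply/dorroh_nilpotent.
Qed.
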